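(* Let $r\ge1$ and let $\gamma=\{\gamma_{ij}\}_{i,j\ge 0}$ be a recursive doubly indexed sequence (RDIS) with characteristic polynomial $P(z,\bar z)=z^{r}-\sum_{0\le l+k\le r-1}a_{lk}\bar z^{l}z^{k}$. Then $\gamma$ is a moment sequence if and only if $M(2r-2)(\gamma)\ge0$.
   Context: RDIS: a sequence $\gamma=\{\gamma_{ij}\}_{i,j\ge0}$ of complex numbers with $\gamma_{00}>0$, $\gamma_{ji}=\overline{\gamma_{ij}}$ is an RDIS with characteristic polynomial $P=z^{r}-\sum_{0\le l+k\le r-1}a_{lk}\bar z^lz^k$ ($a_{lk}\in\mathbb{C}$) if $\gamma_{i,j+r}=\sum_{0\le l+k\le r-1}a_{lk}\gamma_{i+l,j+k}$ for all $i,j\ge0$. $M(n)(\gamma)$ is the moment matrix with rows and columns indexed by the monomials $\bar z^iz^j$, $i+j\le n$, whose entry in row $\bar z^kz^l$, column $\bar z^iz^j$ is $\gamma_{i+l,j+k}$. $\ge0$ means positive semidefinite. $\gamma$ is a moment sequence if there is a positive Borel measure $\mu$ on $\mathbb{C}$ with $\gamma_{ij}=\int\bar z^iz^j\,d\mu$ for all $i,j\ge0$. *)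

(* Defs.v *)
From HB Require Import structures.
From mathcomp Require Import all_boot all_order all_algebra.
From mathcomp Require Import sesquilinear spectral.
From mathcomp Require Import complex.
From mathcomp Require Import all_classical all_reals all_analysis.

Set Implicit Arguments.
Unset Strict Implicit.
Unset Printing Implicit Defensive.

Import Order.TTheory GRing.Theory Num.Theory.
Import numFieldNormedType.Exports.

Local Open Scope ring_scope.
Local Open Scope complex_scope.
Local Open Scope sesquilinear_scope.

(* The order on R[i] is the partial one: 0 < x means that x is real and
   positive. The polynomial z^r - \sum_(l + k <= r - 1) a_lk conj(z)^l z^k is
   represented by its degree r and its coefficients a; only the a l k with
   l + k <= r - 1 matter. *)
Record RDIS (R : realType) (r : nat) (a gamma : nat -> nat -> R[i]) : Prop := {
  RDIS_pos : 0 < gamma 0%N 0%N ;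
  RDIS_conj : forall i j, gamma j i = Num.conj (gamma i j) ;
  RDIS_rec : forall i j, gamma i (j + r)%N =
    \sum_(l < r) \sum_(k < r | (l + k <= r.-1)%N)
      a l k * gamma (i + l)%N (j + k)%N }.

(* (i, j) stands for the monomial conj(z)^i z^j. *)
Definition monomial (n : nat) : finType :=
  {p : 'I_n.+1 * 'I_n.+1 | (p.1 + p.2 <= n)%N}.

Definition conj_exp (n : nat) (p : monomial n) : nat := (val p).1.
Definition hol_exp (n : nat) (p : monomial n) : nat := (val p).2.

(* Row conj(z)^k z^l, column conj(z)^i z^j: the entry is gamma (i + l) (j + k).
   The monomials are numbered by [enum_val]; semidefiniteness does not depend
   on the chosen ordering. *)
Definition moment_matrix (R : realType) (n : nat) (gamma : nat -> nat -> R[i]) :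
    'M[R[i]]_#|monomial n| :=
  \matrix_(s, t) let p := enum_val s in let q := enum_val t in
    gamma (conj_exp q + hol_exp p)%N (hol_exp q + conj_exp p)%N.

(* As 0 <= x in R[i] forces x to be real, a matrix satisfying this is
   Hermitian. *)
Definition psdmx (R : realType) (m : nat) (A : 'M[R[i]]_m) : Prop :=
  forall v : 'cV[R[i]]_m, 0 <= (v^t* *m A *m v) 0 0.

(* The complex plane with its Borel sigma-algebra; R[i]^o carries
   the topology of the modulus. *)
Notation borelC R := (g_sigma_algebraType (@open R[i]^o)).

Definition cintegrable (R : realType) (mu : {measure set (borelC R) -> \bar R})
    (f : R[i] -> R[i]) : Prop :=
  mu.-integrable setT (fun z : borelC R => (complex.Re (f z))%:E) /\
  mu.-integrable setT (fun z : borelC R => (complex.Im (f z))%:E).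

Definition cintegral (R : realType) (mu : {measure set (borelC R) -> \bar R})
    (f : R[i] -> R[i]) : R[i] :=
  (\int[mu]_(z in setT) complex.Re (f z))%R
  +i* (\int[mu]_(z in setT) complex.Im (f z))%R.

Definition moment_sequence (R : realType) (gamma : nat -> nat -> R[i]) : Prop :=
  exists mu : {measure set (borelC R) -> \bar R}, forall i j : nat,
    cintegrable mu (fun z => Num.conj z ^+ i * z ^+ j) /\
    gamma i j = cintegral mu (fun z => Num.conj z ^+ i * z ^+ j).

(* Main.v *)
(* The relation for z^r and its conjugate reduce every monomial to a
   combination of monomials of degree at most 2r - 2, so positivity of M(2r - 2)
   makes gamma a positive functional with a finite dimensional GNS space.
   Multiplication by z on that space is a normal matrix, whose adjoint is
   multiplication by conj(z); diagonalizing it yields a finitely atomic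
   representing measure, with atoms the eigenvalues and masses the squared
   moduli of the coordinates of the vector 1. *)
Require Import Defs.
From mathcomp Require Import all_boot all_order all_algebra.
From mathcomp Require Import sesquilinear spectral complex ring zify.
From mathcomp Require Import all_classical all_reals all_analysis.
From mathcomp Require Import measurable_realfun.

Set Implicit Arguments.
Unset Strict Implicit.
Unset Printing Implicit Defensive.

Import Order.TTheory GRing.Theory Num.Theory.
Import numFieldNormedType.Exports.

Local Open Scope ring_scope.
Local Open Scope sesquilinear_scope.

(** * Gram factorization, normal matrices and finitely atomic moment formulas *)

Section Gram.
Variable C : numClosedFieldType.

Lemma adjmxM m n p (A : 'M[C]_(m, n)) (B : 'M[C]_(n, p)) :
  (A *m B)^t* = B^t* *m A^t*.
Proof. by rewrite trmx_mul map_mxM. Qed.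

Lemma adjmx_inj m n : injective (fun A : 'M[C]_(m, n) => A^t*).
Proof. by move=> A B /(congr1 (fun X => X^t*)); rewrite !trmxCK. Qed.

Lemma adjmx_diag n (d : 'rV[C]_n) :
  (diag_mx d)^t* = diag_mx (map_mx Num.conj d).
Proof. by rewrite tr_diag_mx map_diag_mx. Qed.

(** Spectral theorem: if M = P^* D P with P unitary and D nonnegative, then B = sqrt(D) P works. *)
Lemma psd_square_gram n (M : 'M[C]_n) : M^t* = M ->
    (forall v : 'cV[C]_n, 0 <= (v^t* *m M *m v) 0 0) ->
  exists B : 'M[C]_n, M = B^t* *m B.
Proof.
move=> Mherm Mpsd.
have /orthomx_spectralP : M \is normalmx by apply/normalmxP; rewrite Mherm.
have Pu := spectral_unitarymx M; rewrite invmx_unitary //.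
move: (spectralmx M) (spectral_diag M) Pu => P d Pu eqM.
(* Test positivity on the i-th eigenvector, the i-th column of P^*. *)
have d_ge0 i : 0 <= d 0 i.
  have := Mpsd (P^t* *m (delta_mx 0 i)^T).
  rewrite {}eqM adjmxM trmxCK !mulmxA mulmxtVK // mulmxtVK // trmxK.
  by rewrite map_delta_mx -rowE trmx_delta -colE !mxE eqxx mulr1n.
pose s := map_mx sqrtC d; exists (diag_mx s *m P).
rewrite adjmxM adjmx_diag mulmxA -[P^t* *m _ *m _]mulmxA mulmx_diag.
rewrite {1}eqM; congr (_ *m diag_mx _ *m _); apply/rowP => i; rewrite !mxE.
rewrite (geC0_conj _) ?sqrtC_ge0 //.
by rewrite -expr2 sqrtCK.
Qed.

(** The columns of a square Gram factor are rewritten in coordinates for an orthonormal basis of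
    their span. The columns of the new factor then span the whole space, which is what [row_free]
    expresses. *)
Lemma psd_gram n (M : 'M[C]_n) : M^t* = M ->
    (forall v : 'cV[C]_n, 0 <= (v^t* *m M *m v) 0 0) ->
  exists m (B : 'M[C]_(m, n)), row_free B /\ M = B^t* *m B.
Proof.
move=> Mherm /(psd_square_gram Mherm)[B ->].
(* Gram-Schmidt on a row basis of B^*; the projection Q^* Q then fixes B^*. *)
have [k [Q [Qu /submxP[X eqB] rkQ]]] : exists k (Q : 'M[C]_(k, n)),
    [/\ Q \is unitarymx, (B^t* <= Q)%MS & (k <= \rank (B^t*))%N].
  exists (\rank (B^t*)), (schmidt (row_base (B^t*))); split=> //.
    by apply: schmidt_unitarymx; exact: rank_leq_row.
  by rewrite (eqmx_schmidt_free (row_base_free _)) eq_row_base.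
have BQQ : B^t* *m Q^t* *m Q = B^t* by rewrite eqB mulmxtVK.
exists k, (Q *m B); split; last by rewrite adjmxM mulmxA BQQ.
rewrite -row_leq_rank -mxrank_tr -(mxrank_map Num.conj) adjmxM.
by rewrite (leq_trans rkQ) // -[X in (\rank X <= _)%N]BQQ mxrankM_maxl.
Qed.

(* [b i j] plays the role of the monomial conj(z)^i z^j in the GNS space,
   on which multiplication by z is a normal operator. *)
Lemma normal_moments m n (b : nat -> nat -> 'cV[C]_m) (e : 'I_n -> nat * nat)
    (g : nat -> nat -> C) :
    row_free (\matrix_(i, t) b (e t).1 (e t).2 i 0) ->
    (forall i j k l, ((b k l)^t* *m b i j) 0 0 = g (i + l)%N (j + k)%N) ->
  exists w lam : 'I_m -> C, forall i j,
    g i j = \sum_k `|w k| ^+ 2 * (Num.conj (lam k) ^+ i * lam k ^+ j).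
Proof.
set B := (X in row_free X) => Bfree bE.
have colB t : col t B = b (e t).1 (e t).2.
  by apply/colP => i; rewrite !mxE.
(* The columns of B span, so only 0 is orthogonal to every [b k l]. *)
have orth0 (u : 'cV[C]_m) :
    (forall k l, ((b k l)^t* *m u) 0 0 = 0) -> u = 0.
  move=> u0; apply: adjmx_inj; rewrite /= trmx0 map_mx0.
  apply: (row_free_inj Bfree); rewrite mul0mx.
  apply: adjmx_inj; rewrite /= trmx0 map_mx0 adjmxM trmxCK.
  apply/matrixP => t o; rewrite ord1 [RHS]mxE -[RHS](u0 (e t).1 (e t).2).
  by rewrite -colB !mxE; apply: eq_bigr => i _; rewrite !mxE.
(* B' holds the basis monomials multiplied by z. As B has a right inverse, A is a candidate for
   multiplication by z; [AE] shows that it acts correctly on every monomial. *)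
pose B' := \matrix_(i, t) b (e t).1 (e t).2.+1 i 0.
have colB' t : col t B' = b (e t).1 (e t).2.+1.
  by apply/colP => i; rewrite !mxE.
pose A := B' *m pinvmx B.
(* Moving z across the inner product turns it into conj(z): both sides are the same moment. *)
have BB' k l : (b k l)^t* *m B' = (b k.+1 l)^t* *m B.
  apply/matrixP => o t; rewrite ord1.
  have entryE (u : 'cV[C]_m) (X : 'M[C]_(m, n)) :
      (u^t* *m X) 0 t = (u^t* *m col t X) 0 0.
    by rewrite !mxE; apply: eq_bigr => h _; rewrite !mxE.
  by rewrite !entryE colB colB' !bE addSnnS.
have AE i j : A *m b i j = b i j.+1.
  pose x := pinvmx B *m b i j.
  have bx : B *m x = b i j by rewrite mulmxA mulmxVp ?mul1mx.
  apply/subr0_eq/orth0 => k l.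
  rewrite mulmxBr mxE [X in _ + X]mxE bE addSnnS -bE.
  by rewrite -(mulmxA B') -/x mulmxA BB' -mulmxA bx subrr.
have A'E k l : A^t* *m b k l = b k.+1 l.
  apply/subr0_eq/orth0 => i j.
  rewrite mulmxBr mxE [X in _ + X]mxE bE mulmxA -adjmxM AE bE.
  by rewrite addSnnS subrr.
clearbody A.
(* Both products send [b i j] to [b i.+1 j.+1], and it suffices to compare them on the spanning
   columns of B. *)
have Anormal : A \is normalmx.
  apply/normalmxP/(row_free_inj Bfree)/matrixP => s t.
  suff: col t (A *m A^t* *m B) = col t (A^t* *m A *m B).
    by move=> /colP/(_ s); rewrite [LHS]mxE [RHS]mxE.
  by rewrite !colE -!mulmxA -colE colB !(AE, A'E).
have /orthomx_spectralP := Anormal.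
have Pu := spectral_unitarymx A; rewrite invmx_unitary //.
move: (spectralmx A) (spectral_diag A) Pu => P d Pu eqA.
have PP : P^t* *m P = 1%:M by rewrite -invmx_unitary ?mulVmx ?unitarymx_unit.
have PA : P *m A = diag_mx d *m P.
  by rewrite eqA !mulmxA (unitarymxP Pu) mul1mx.
have PA' : P *m A^t* = diag_mx (map_mx Num.conj d) *m P.
  by rewrite eqA !adjmxM trmxCK adjmx_diag !mulmxA (unitarymxP Pu) mul1mx.
pose v := P *m b 0%N 0%N.
have Pb i j k : (P *m b i j) k 0 = Num.conj (d 0 k) ^+ i * d 0 k ^+ j * v k 0.
  elim: i k => [|i IH] k.
    elim: j k => [|j IH] k; first by rewrite !mul1r.
    by rewrite -AE mulmxA PA -mulmxA mul_diag_mx [LHS]mxE IH exprS; ring.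
  rewrite -A'E mulmxA PA' -mulmxA mul_diag_mx [LHS]mxE.
  by rewrite [X in X * _]mxE IH exprS; ring.
exists (fun k => v k 0), (fun k => d 0 k) => i j.
(* The moment is the inner product of [b i j] with the vector 1, computed in the eigenbasis. *)
have := bE i j 0%N 0%N; rewrite !addn0 => <-.
rewrite -[b i j]mul1mx -PP -mulmxA mulmxA -adjmxM mxE.
have vE k : (v^t*) 0 k = Num.conj (v k 0) by rewrite mxE mxE.
by apply: eq_bigr => k _; rewrite Pb vE normCK; ring.
Qed.

(* The column of the infinite moment matrix [g] with entries [f] is a
   combination of the columns of the monomials [e t]. *)
Definition shift_span n (e : 'I_n -> nat * nat)
    (g f : nat -> nat -> C) : Prop :=
  exists c : 'I_n -> C,
    forall k l, f k l = \sum_t c t * g ((e t).1 + k)%N ((e t).2 + l)%N.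

Lemma shift_span_eq n (e : 'I_n -> nat * nat) g f f' :
  (forall k l, f k l = f' k l) -> shift_span e g f' -> shift_span e g f.
Proof. by move=> ff' [c cE]; exists c => k l; rewrite ff'. Qed.

Lemma shift_span_base n (e : 'I_n -> nat * nat) g t :
  shift_span e g (fun k l => g ((e t).1 + k)%N ((e t).2 + l)%N).
Proof.
exists (fun s => (s == t)%:R) => k l; rewrite (bigD1 t) //= eqxx mul1r.
by rewrite big1 ?addr0 // => s /negPf->; rewrite mul0r.
Qed.

Lemma shift_spanZ n (e : 'I_n -> nat * nat) g f x :
  shift_span e g f -> shift_span e g (fun k l => x * f k l).
Proof.
move=> [c cE]; exists (fun t => x * c t) => k l.
by rewrite cE mulr_sumr; apply: eq_bigr => t _; rewrite mulrA.
Qed.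

Lemma shift_span_sum n (e : 'I_n -> nat * nat) g (I : finType) (P : pred I)
    (F : I -> nat -> nat -> C) :
  (forall i, P i -> shift_span e g (F i)) ->
  shift_span e g (fun k l => \sum_(i | P i) F i k l).
Proof.
move=> spanF.
(* Guarding the equation by [P i] lets choice range over all of [I], with the zero family outside
   [P]. *)
have /choice[c cE] i : exists c : 'I_n -> C, P i -> forall k l,
    F i k l = \sum_t c t * g ((e t).1 + k)%N ((e t).2 + l)%N.
  have [Pi|/negP nPi] := boolP (P i); last by exists (fun=> 0).
  by have [c cE] := spanF i Pi; exists c.
exists (fun t => \sum_(i | P i) c i t) => k l.
under eq_bigr => i Pi do rewrite cE //.
by rewrite exchange_big; apply: eq_bigr => t _; rewrite mulr_suml.
Qed.

(** GNS construction: the columns of a Gram factor of M represent the monomials [e t], the span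
    hypothesis extends them to all monomials, and inner products remain moments, so [normal_moments]
    applies. *)
Lemma flat_moments n (e : 'I_n -> nat * nat) (g : nat -> nat -> C) :
    (forall i j, g j i = Num.conj (g i j)) ->
    (forall i j, shift_span e g (fun k l => g (i + k)%N (j + l)%N)) ->
    let M := \matrix_(s, t)
      g ((e t).1 + (e s).2)%N ((e t).2 + (e s).1)%N : 'M[C]_n in
    (forall v : 'cV[C]_n, 0 <= (v^t* *m M *m v) 0 0) ->
  exists m (w lam : 'I_m -> C), forall i j,
    g i j = \sum_k `|w k| ^+ 2 * (Num.conj (lam k) ^+ i * lam k ^+ j).
Proof.
move=> gconj gspan M Mpsd.
have Mherm : M^t* = M.
  apply/matrixP => s t; rewrite !mxE -gconj.
  by rewrite addnC [X in g _ X]addnC.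
have [m [B [Bfree eqM]]] := psd_gram Mherm Mpsd.
have BE s t : ((col s B)^t* *m col t B) 0 0 =
    g ((e t).1 + (e s).2)%N ((e t).2 + (e s).1)%N.
  transitivity (M s t); last by rewrite mxE.
  by rewrite eqM !mxE; apply: eq_bigr => i _; rewrite !mxE.
have /choice[c cE] (p : nat * nat) : exists c : 'I_n -> C, forall k l,
    g (p.1 + k)%N (p.2 + l)%N =
    \sum_t c t * g ((e t).1 + k)%N ((e t).2 + l)%N by exact: gspan.
pose b i j := \sum_t c (i, j) t *: col t B.
have bB s i j : ((col s B)^t* *m b i j) 0 0 = g (i + (e s).2)%N (j + (e s).1)%N.
  rewrite (cE (i, j)) mulmx_sumr summxE; apply: eq_bigr => t _.
  by rewrite -scalemxAr [LHS]mxE BE.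
have dotC (u v : 'cV[C]_m) :
    (u^t* *m v) 0 0 = Num.conj ((v^t* *m u) 0 0).
  by rewrite -{1}(trmxCK v) -adjmxM mxE mxE.
have bE i j k l : ((b k l)^t* *m b i j) 0 0 = g (i + l)%N (j + k)%N.
  rewrite dotC gconj addnC [X in g _ X]addnC (cE (k, l)); congr Num.conj.
  rewrite mulmx_sumr summxE; apply: eq_bigr => s _.
  rewrite -scalemxAr [LHS]mxE; congr (_ * _).
  by rewrite dotC bB -gconj; congr g; exact: addnC.
exists m; apply: (normal_moments (e := e)) bE.
suff -> : (\matrix_(i, t) b (e t).1 (e t).2 i 0) = B by [].
apply/matrixP => i t; rewrite mxE.
(* The coefficients chosen for [e t] need not be a unit vector; the two vectors agree because they
   have equal inner products with the spanning columns of B. *)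
suff -> : b (e t).1 (e t).2 = col t B by rewrite mxE.
apply: adjmx_inj; apply: (row_free_inj Bfree).
apply: adjmx_inj; rewrite /= !adjmxM !trmxCK.
apply/matrixP => s o; rewrite ord1.
have entryE (u : 'cV[C]_m) : (B^t* *m u) s 0 = ((col s B)^t* *m u) 0 0.
  by rewrite !mxE; apply: eq_bigr => h _; rewrite !mxE.
by rewrite !entryE bB BE.
Qed.

End Gram.

Local Open Scope classical_set_scope.
Local Open Scope complex_scope.

(** * Measurability of the monomials in z and conj(z) *)

Section Complex_measurability.
Variable R : realType.
Local Notation C := R[i].

Lemma normc_ge_Im (z : C) : `|complex.Im z|%:C <= `|z|.
Proof.
case: z => x y; rewrite normc_def lecR /=
  -sqrtr_sqr ler_sqrt ?lerDr ?sqr_ge0 //.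
by rewrite addr_ge0 ?sqr_ge0.
Qed.

(** Open intervals generate the Borel sets of the line, and their preimages under a contraction are
    open. *)
Lemma measurable_contraction (f : C -> R) :
    (forall z w, `|f z - f w|%:C <= `|z - w|) ->
  measurable_fun setT (f : borelC R -> R).
Proof.
move=> fcontr; apply: (measurability _ (RGenOpens.measurableE R)).
move=> _ [_ [a [b ->] <-]]; rewrite setTI.
apply: sub_sigma_algebra => /=.
have oab : open `]a, b[%classic by exact: interval_open.
rewrite openE => z /= zab.
have : nbhs (f z) `]a, b[%classic by apply: open_nbhs_nbhs.
move=> /nbhs_ballP[e /= e0 fe].
apply/nbhs_ballP; exists e%:C => /=; first by rewrite ltcR.
move=> w zw; apply: fe; rewrite /ball /= in zw *.
by rewrite -ltcR; apply: le_lt_trans (fcontr _ _) zw.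
Qed.

Lemma measurable_Re : measurable_fun setT (@complex.Re R : borelC R -> R).
Proof.
apply: measurable_contraction => z w.
by rewrite -raddfB normc_ge_Re.
Qed.

Lemma measurable_Im : measurable_fun setT (@complex.Im R : borelC R -> R).
Proof.
apply: measurable_contraction => z w.
by rewrite -raddfB normc_ge_Im.
Qed.

Definition cmeasurable (f : C -> C) : Prop :=
  measurable_fun setT (@complex.Re R \o f : borelC R -> R) /\
  measurable_fun setT (@complex.Im R \o f : borelC R -> R).

Lemma cmeasurableM f g :
  cmeasurable f -> cmeasurable g -> cmeasurable (fun z => f z * g z).
Proof.
move=> [mRf mIf] [mRg mIg]; split.
  rewrite (_ : _ \o _ = fun z => complex.Re (f z) * complex.Re (g z) -
    complex.Im (f z) * complex.Im (g z)).
    by apply: measurable_funB; apply: measurable_funM.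
  by apply/funext => z /=; case: (f z) (g z) => [x y] [x' y'].
rewrite (_ : _ \o _ = fun z => complex.Re (f z) * complex.Im (g z) +
    complex.Im (f z) * complex.Re (g z)).
  by apply: measurable_funD; apply: measurable_funM.
by apply/funext => z /=; case: (f z) (g z) => [x y] [x' y'].
Qed.

Lemma cmeasurableX f n : cmeasurable f -> cmeasurable (fun z => f z ^+ n).
Proof.
move=> mf; elim: n => [|n IH].
  by split; exact: measurable_cst.
under eq_fun do rewrite exprS; exact: cmeasurableM.
Qed.

Lemma cmeasurable_id : cmeasurable id.
Proof. by split; [exact: measurable_Re|exact: measurable_Im]. Qed.

Lemma cmeasurable_conj : cmeasurable Num.conj.
Proof.
split.
  rewrite (_ : _ \o _ = @complex.Re R); first exact: measurable_Re.
  by apply/funext => -[].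
rewrite (_ : _ \o _ = fun z => - complex.Im z).
  by apply: measurable_funN; exact: measurable_Im.
by apply/funext => -[].
Qed.

Lemma cmeasurable_monomial i j :
  cmeasurable (fun z => Num.conj z ^+ i * z ^+ j).
Proof.
apply: cmeasurableM; apply: cmeasurableX.
  exact: cmeasurable_conj.
exact: cmeasurable_id.
Qed.

End Complex_measurability.

(** * Linearity and positivity of the complex integral *)

Section Complex_integral.
Variables (R : realType) (mu : {measure set (borelC R) -> \bar R}).
Local Notation C := R[i].

Lemma cintegrable0 : cintegrable mu (fun=> 0) /\ cintegral mu (fun=> 0) = 0.
Proof.
split; first by split; exact: integrable0.
by rewrite /cintegral /Rintegral integral0.
Qed.

Lemma cintegrableD f g : cintegrable mu f -> cintegrable mu g ->
  cintegrable mu (fun z => f z + g z) /\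
  cintegral mu (fun z => f z + g z) = cintegral mu f + cintegral mu g.
Proof.
move=> [fR fI] [gR gI].
have ReD z : complex.Re (f z + g z) = complex.Re (f z) + complex.Re (g z).
  exact: raddfD.
have ImD z : complex.Im (f z + g z) = complex.Im (f z) + complex.Im (g z).
  exact: raddfD.
split.
  split.
    under eq_fun do rewrite ReD EFinD; exact: integrableD.
  under eq_fun do rewrite ImD EFinD; exact: integrableD.
rewrite /cintegral; under eq_Rintegral do rewrite ReD.
rewrite RintegralD //.
under [X in _ +i* X = _]eq_Rintegral do rewrite ImD.
by rewrite RintegralD.
Qed.

Lemma cintegrableZ x f : cintegrable mu f ->
  cintegrable mu (fun z => x * f z) /\
  cintegral mu (fun z => x * f z) = x * cintegral mu f.
Proof.
case: x => x y [fR fI].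
have ReM z : complex.Re ((x +i* y) * f z) =
    x * complex.Re (f z) - y * complex.Im (f z) by case: (f z).
have ImM z : complex.Im ((x +i* y) * f z) =
    x * complex.Im (f z) + y * complex.Re (f z) by case: (f z).
have iZ (h : C -> R) k : mu.-integrable setT (fun z : borelC R => (h z)%:E) ->
    mu.-integrable setT (fun z : borelC R => (k * h z)%:E).
  by move=> ih; under eq_fun do rewrite EFinM; exact: integrableZl.
split.
  split.
    under eq_fun do rewrite ReM EFinB.
    by apply: integrableB => //; exact: iZ.
  under eq_fun do rewrite ImM EFinD.
  by apply: integrableD => //; exact: iZ.
rewrite /cintegral; under eq_Rintegral do rewrite ReM.
rewrite RintegralB ?RintegralZl //; [|exact: iZ..].
under [X in _ +i* X = _]eq_Rintegral do rewrite ImM.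
by rewrite RintegralD ?RintegralZl //; exact: iZ.
Qed.

Lemma cintegral_lincomb (I : Type) (s : seq I) (c : I -> C) (F : I -> C -> C) :
    (forall i, cintegrable mu (F i)) ->
  cintegrable mu (fun z => \sum_(i <- s) c i * F i z) /\
  cintegral mu (fun z => \sum_(i <- s) c i * F i z) =
    \sum_(i <- s) c i * cintegral mu (F i).
Proof.
move=> iF; elim: s => [|i s [IH IHE]].
  by rewrite big_nil; under eq_fun do rewrite big_nil; exact: cintegrable0.
rewrite big_cons; under eq_fun do rewrite big_cons.
have [iZ ZE] := cintegrableZ (c i) (iF i).
have [iD DE] := cintegrableD iZ IH.
by rewrite DE ZE IHE; split.
Qed.

Lemma cintegral_ge0 (f : C -> C) : (forall z, 0 <= f z) -> 0 <= cintegral mu f.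
Proof.
move=> f0; rewrite lecE /=; apply/andP; split.
  (* In the partial order of [R[i]], [0 <= f z] forces the imaginary part to vanish. *)
  rewrite /Rintegral integral0_eq // => z _.
  by move: (f0 z); rewrite lecE => /andP[/eqP->].
by apply: Rintegral_ge0 => z _; move: (f0 z); rewrite lecE => /andP[].
Qed.

End Complex_integral.

(** The quadratic form at v is the integral of the squared modulus of the polynomial with
    coefficients v on the monomials [e t]. *)
Lemma moment_psd (R : realType) n (e : 'I_n -> nat * nat)
    (g : nat -> nat -> R[i]) : moment_sequence g ->
  let M := \matrix_(s, t)
    g ((e t).1 + (e s).2)%N ((e t).2 + (e s).1)%N : 'M[R[i]]_n in
  forall v : 'cV_n, 0 <= (v^t* *m M *m v) 0 0.
Proof.
move=> [mu muE] M v.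
pose F (p : 'I_n * 'I_n) (z : R[i]) := Num.conj z ^+ ((e p.2).1 + (e p.1).2) *
  z ^+ ((e p.2).2 + (e p.1).1).
pose c (p : 'I_n * 'I_n) := Num.conj (v p.1 0) * v p.2 0.
have iF p : cintegrable mu (F p) by exact: (muE _ _).1.
rewrite (_ : (_ *m _ *m _) 0 0 = cintegral mu (fun z => \sum_p c p * F p z)).
  apply: cintegral_ge0 => z.
  rewrite (_ : \sum_p _ =
    `|\sum_t v t 0 * (Num.conj z ^+ (e t).1 * z ^+ (e t).2)| ^+ 2).
    by rewrite exprn_ge0.
  rewrite normCKC rmorph_sum big_distrlr pair_bigA /=.
  apply: eq_bigr => p _; rewrite /c /F !rmorphM !rmorphXn /= conjCK !exprD.
  ring.
rewrite (cintegral_lincomb _ _ iF).2 -mulmxA mxE.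
rewrite -(pair_bigA _ (fun s t => c (s, t) * cintegral mu (F (s, t)))) /=.
apply: eq_bigr => s _; rewrite [X in _ * X]mxE mulr_sumr; apply: eq_bigr => t _.
rewrite /c !mxE; have [_ ->] :=
  muE ((e t).1 + (e s).2)%N ((e t).2 + (e s).1)%N.
by ring.
Qed.

(** * Integration against finitely atomic measures *)

Section Atomic_measure.
Variables (R : realType) (m : nat) (wt : nat -> {nonneg R}).
Variable (pt : nat -> borelC R).

Definition atomic_measure : {measure set (borelC R) -> \bar R} :=
  msum (fun k => mscale (wt k) (dirac (pt k))) m.

Lemma ge0_integral_atomic (h : borelC R -> R) : (forall z, 0 <= h z) ->
  measurable_fun setT h ->
  (\int[atomic_measure]_z (h z)%:E =
    (\sum_(k < m) (wt k)%:num * h (pt k))%:E)%E.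
Proof.
move=> h0 mh.
have mh' : measurable_fun setT (EFin \o h) by exact/measurable_EFinP.
rewrite ge0_integral_measure_sum //; last by move=> z _; rewrite lee_fin.
rewrite -sumEFin; apply: eq_bigr => k _.
rewrite ge0_integral_mscale //; last by move=> z _; rewrite lee_fin.
by rewrite integral_dirac // diracT mul1e.
Qed.

Lemma integrable_atomic (h : borelC R -> R) : measurable_fun setT h ->
  atomic_measure.-integrable setT (EFin \o h).
Proof.
move=> mh; apply/integrableP; split; first exact/measurable_EFinP.
rewrite [ltLHS](ge0_integral_atomic (h := fun z => `|h z|)) ?ltry //.
exact: measurableT_comp.
Qed.

Lemma Rintegral_atomic (h : borelC R -> R) : measurable_fun setT h ->
  (\int[atomic_measure]_z h z)%R = \sum_(k < m) (wt k)%:num * h (pt k).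
Proof.
move=> mh; rewrite /Rintegral integralE funerpos funerneg.
rewrite !ge0_integral_atomic //;
  [|exact: measurable_funrneg|exact: measurable_funrpos].
rewrite -EFinB /= -sumrB; apply: eq_bigr => k _; rewrite -mulrBr.
by rewrite -[in RHS](funrposBneg h).
Qed.

Lemma cintegral_atomic f : cmeasurable f -> cintegrable atomic_measure f /\
  cintegral atomic_measure f = \sum_(k < m) ((wt k)%:num)%:C * f (pt k).
Proof.
move=> [mR mI]; split; first by split; exact: integrable_atomic.
rewrite /cintegral !Rintegral_atomic //.
apply/eqP; rewrite eq_complex; apply/andP; split; apply/eqP.
  rewrite raddf_sum; apply: eq_bigr => k _ /=.
  by case: (f _) => x y /=; rewrite mul0r subr0.
rewrite raddf_sum; apply: eq_bigr => k _ /=.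
by case: (f _) => x y /=; rewrite mul0r addr0.
Qed.

End Atomic_measure.

(** * Degree reduction for an RDIS and the equivalence *)

Definition exponents n (t : 'I_#|monomial n|) : nat * nat :=
  (conj_exp (enum_val t), hol_exp (enum_val t)).

(* A monomial of degree above 2r - 2 has an exponent at least r, hence reduces
   to lower degree. *)
Lemma RDIS_shift_span (R : realType) (r : nat) (a gamma : nat -> nat -> R[i])
    (hr : (1 <= r)%N) (hgamma : RDIS r a gamma) i j :
  shift_span (@exponents (2 * r - 2)) gamma
    (fun k l => gamma (i + k)%N (j + l)%N).
Proof.
have [d] := ubnP (i + j)%N; elim: d i j => // d IH i j.
rewrite ltnS => ijd.
have [ijr|] := leqP (i + j) (2 * r - 2).
  have iP : (i < (2 * r - 2).+1)%N by lia.
  have jP : (j < (2 * r - 2).+1)%N by lia.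
  pose p : monomial (2 * r - 2) :=
    exist _ (Ordinal iP, Ordinal jP) ijr.
  have := shift_span_base (@exponents (2 * r - 2)) gamma (enum_rank p).
  by rewrite /exponents enum_rankK.
have [rj _|jr ijr] := leqP r j.
  have -> : j = (j - r + r)%N by rewrite subnK.
  move: (j - r)%N (subnK rj) => j' jE.
  apply: shift_span_eq => [k l|]; first by rewrite addnAC (RDIS_rec hgamma).
  apply: shift_span_sum => s _; apply: shift_span_sum => t st.
  apply: shift_spanZ.
  apply: shift_span_eq (IH (i + s)%N (j' + t)%N _) => [k l|]; last by lia.
  by rewrite addnAC (addnAC j').
(* Here i + j is at least 2r - 1 and j at most r - 1; the conjugate of the recursion lowers the
   exponent of conj(z). *)
have ri : (r <= i)%N by lia.
have -> : i = (i - r + r)%N by rewrite subnK.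
move: (i - r)%N (subnK ri) => i' iE.
apply: (shift_span_eq (f' := fun k l =>
    \sum_(s < r) \sum_(t < r | (s + t <= r.-1)%N)
      Num.conj (a s t) * gamma (i' + k + t)%N (j + l + s)%N)) => [k l|].
  rewrite addnAC (RDIS_conj hgamma) (RDIS_rec hgamma) rmorph_sum.
  apply: eq_bigr => s _; rewrite rmorph_sum; apply: eq_bigr => t _.
  by rewrite rmorphM /= -(RDIS_conj hgamma).
apply: shift_span_sum => s _; apply: shift_span_sum => t st.
apply: shift_spanZ.
apply: shift_span_eq (IH (i' + t)%N (j + s)%N _) => [k l|]; last by lia.
by rewrite addnAC (addnAC j).
Qed.

Theorem corollary16 (R : realType) (r : nat) (a gamma : nat -> nat -> complex R)
    (hr : (1 <= r)%N) (hgamma : @RDIS R r a gamma) :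
  @moment_sequence R gamma <-> psdmx (moment_matrix (2 * r - 2)%N gamma).
Proof.
split=> [/moment_psd gamma_psd v|gamma_psd].
  (* For [exponents], the matrix of [moment_psd] is [moment_matrix] by conversion. *)
  exact: (gamma_psd _ (@exponents (2 * r - 2)) v).
have [m [w [lam gammaE]]] :=
  flat_moments (RDIS_conj hgamma) (RDIS_shift_span hr hgamma) gamma_psd.
(* [atomic_measure] takes sequences, so the finite families are padded; only indices below m enter
   the sum. *)
pose ext T (x0 : T) (f : 'I_m -> T) k := oapp f x0 (insub k).
have extE T (x0 : T) f (k : 'I_m) : ext T x0 f k = f k by rewrite /ext valK.
(* The mass is the squared modulus of [w k], written as a nonnegative real. *)
pose wt k : {nonneg R} := NngNum (addr_ge0
  (sqr_ge0 (complex.Re (ext _ 0 w k))) (sqr_ge0 (complex.Im (ext _ 0 w k)))).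
exists (atomic_measure m wt (ext _ 0 lam)) => i j.
have [imu ->] :=
  cintegral_atomic m wt (ext _ 0 lam) (@cmeasurable_monomial R i j).
split=> //; rewrite gammaE; apply: eq_bigr => k _.
by rewrite extE /wt /= extE add_Re2_Im2.
Qed.
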